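(* Let $\langle\mathfrak{B},\mathsf{C}\rangle$ be a Boolean contact algebra satisfying the extensionality condition: for every $x\in B$ with $x\neq\mathbf{0}$ there is $y\in B$ with $y\neq\mathbf{0}$ and $y\ll x$. Then the following are equivalent: (a) $\langle\mathfrak{B},\mathsf{C}\rangle$ satisfies (C4$^c$); (b) every region $x\in B$ is isolated, i.e. $x\ll x$; (c) the contact relation and the overlap relation coincide, i.e. $\mathsf{C}=\mathsf{O}$.
   Context: A Boolean contact algebra is a pair $\langle\mathfrak{B},\mathsf{C}\rangle$ where $\mathfrak{B}=\langle B,\cdot,+,-,\mathbf{0},\mathbf{1}\rangle$ is a Boolean algebra (elements of $B$ are called regions) and $\mathsf{C}\subseteq B\times B$ satisfies, for all $x,y,z\in B$: (C0) not $\mathbf{0}\mathrel{\mathsf{C}}x$; (C1) if $x\le y$ and $x\ne\mathbf{0}$, then $x\mathrel{\mathsf{C}}y$; (C2) if $x\mathrel{\mathsf{C}}y$, then $y\mathrel{\mathsf{C}}x$; (C3) if $x\le y$ and $z\mathrel{\mathsf{C}}x$, then $z\mathrel{\mathsf{C}}y$; (C4) if $x\mathrel{\mathsf{C}}(y+z)$, then $x\mathrel{\mathsf{C}}y$ or $x\mathrel{\mathsf{C}}z$. Overlap: $x\mathrel{\mathsf{O}}y\iff x\cdot y\neq\mathbf{0}$. Non-tangential part: $x\ll y$ iff not $x\mathrel{\mathsf{C}}(-y)$. (C4$^c$): for every $x\in B$ and every family $J\subseteq B$ whose supremum $\bigvee J$ exists, if $x\mathrel{\mathsf{C}}\bigvee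 J$, then there is $y\in J$ with $x\mathrel{\mathsf{C}}y$. *)

(* Defs.v *)
From mathcomp Require Import all_boot all_order.
From mathcomp Require Import boolp classical_sets.

Set Implicit Arguments.
Unset Strict Implicit.
Unset Printing Implicit Defensive.

Import Order.TTheory.
Local Open Scope order_scope.

(* MathComp's ctbDistrLatticeType is the structure of Boolean algebras: meet,
   join, complement, \bot and \top.  It does not exclude \bot = \top. *)

Record is_contact (d : Order.disp_t) (B : ctbDistrLatticeType d)
    (C : B -> B -> Prop) : Prop := IsContact {
  contact_C0 : forall x : B, ~ C \bot x;
  contact_C1 : forall x y : B, x <= y -> x <> \bot -> C x y;
  contact_C2 : forall x y : B, C x y -> C y x;
  contact_C3 : forall x y z : B, x <= y -> C z x -> C z y;
  contact_C4 : forall x y z : B, C x (Order.join y z) -> C x y \/ C x z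
}.

Definition overlap (d : Order.disp_t) (B : ctbDistrLatticeType d)
  (x y : B) : Prop := Order.meet x y <> \bot.

Definition ntpart (d : Order.disp_t) (B : ctbDistrLatticeType d)
  (C : B -> B -> Prop) (x y : B) : Prop := ~ C x (Order.compl y).

Definition isolated (d : Order.disp_t) (B : ctbDistrLatticeType d)
  (C : B -> B -> Prop) (x : B) : Prop := ntpart C x x.

Definition contact_extensional (d : Order.disp_t) (B : ctbDistrLatticeType d)
    (C : B -> B -> Prop) : Prop :=
  forall x : B, x <> \bot -> exists y : B, y <> \bot /\ ntpart C y x.

(* J is arbitrary, possibly empty; isLub J s says that the supremum of J exists
   and is s (B is not assumed complete). *)
Definition contact_C4c (d : Order.disp_t) (B : ctbDistrLatticeType d)
    (C : B -> B -> Prop) : Prop :=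
  forall (x : B) (J : set B) (s : B),
    isLub J s -> C x s -> exists y : B, J y /\ C x y.

(* Main.v *)
(* Under extensionality every region x is the supremum of its non-tangential
   parts, so (C4^c) applied to -x C x would give y << x with -x C y; hence x is
   isolated.  If all regions are isolated, then C = O, because disjoint x, y
   satisfy x <= -y; and O is completely additive, because x is disjoint from
   all of J iff -x is an upper bound of J. *)
Require Import Defs.
From mathcomp Require Import all_boot all_order.
From mathcomp Require Import boolp classical_sets.

Set Implicit Arguments.
Unset Strict Implicit.
Unset Printing Implicit Defensive.

Import Order.Theory.
Local Open Scope order_scope.
Local Open Scope classical_set_scope.

Section ContactAlgebra.
Context {d : Order.disp_t} {B : ctbDistrLatticeType d} {C : B -> B -> Prop}.
Hypothesis contactC : is_contact C.

Lemma disjoint_lexC (x y : B) : Order.meet x y = \bot <-> x <= Order.compl y.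
Proof. by rewrite -disj_leC; split=> /eqP. Qed.

(** The meet is nonzero, so (C1) puts it in contact with [x]; by symmetry and (C3) it can be
    enlarged to [y]. *)
Lemma overlap_contact (x y : B) : overlap x y -> C x y.
Proof.
move=> Oxy; apply: (contact_C3 contactC (leIr y x)).
apply: (contact_C2 contactC).
exact: (contact_C1 contactC (leIl x y) Oxy).
Qed.

(** Otherwise [x] would overlap the complement of [y] and hence touch it. *)
Lemma ntpart_le (x y : B) : ntpart C x y -> x <= y.
Proof.
move=> xy; rewrite -[y]complK; apply/disjoint_lexC.
by apply: contrapT => /overlap_contact.
Qed.

Lemma ntpart_trans_le (x y z : B) : ntpart C x y -> y <= z -> ntpart C x z.
Proof.
move=> xy yz Cxz; apply: xy.
by apply: (contact_C3 contactC) Cxz; rewrite leC.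
Qed.

Lemma isLub_ntpart (x : B) :
  contact_extensional C -> isLub [set y | ntpart C y x] x.
Proof.
move=> extC; split=> [y /ntpart_le //|b ub_b].
(* If [x] had a nonzero part outside [b], extensionality would give a nonzero [y] non-tangential in
   that part, hence in [x]. Then [y] lies below both [b] and its complement. *)
rewrite -[b]complK; apply/disjoint_lexC; apply: contrapT => /extC[y [y0 yxb]].
apply: y0; rewrite -(meetxx y); apply/disjoint_lexC.
have yb : y <= b by apply: ub_b; apply: ntpart_trans_le yxb (leIl _ _).
by rewrite (le_trans (ntpart_le yxb))// (le_trans (leIr _ _))// leC.
Qed.

Lemma contact_C4c_isolated :
  contact_extensional C -> contact_C4c C -> forall x : B, isolated C x.
Proof.
move=> extC C4c x /(contact_C2 contactC) Cx.
have [y [yx /(contact_C2 contactC)]] := C4c _ _ _ (isLub_ntpart x extC) Cx.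
exact: yx.
Qed.

Lemma isolated_contactE : (forall x : B, isolated C x) -> C = @overlap d B.
Proof.
move=> isoC; apply/funext => x; apply/funext => y; apply/propext; split.
  (* The contact of [y] with [x] spreads to the complement of [y], against the isolation of [y]. *)
  move=> Cxy /disjoint_lexC xy; apply: (isoC y).
  apply: (contact_C3 contactC xy).
  exact: (contact_C2 contactC).
exact: overlap_contact.
Qed.

End ContactAlgebra.

Lemma overlap_isolated (d : Order.disp_t) (B : ctbDistrLatticeType d) (x : B) :
  isolated (@overlap d B) x.
Proof. by apply; rewrite meetxC. Qed.

Lemma overlap_C4c (d : Order.disp_t) (B : ctbDistrLatticeType d) :
  contact_C4c (@overlap d B).
Proof.
move=> x J s [_ s_least] Oxs; apply: contrapT => disjJ; apply: Oxs.
(* The goal becomes that [s] lies below the complement of [x]; leastness reduces it to each member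
   of [J]. *)
rewrite meetC; apply/disjoint_lexC; apply: s_least => y Jy.
apply/disjoint_lexC; rewrite meetC.
by apply: contrapT => Oxy; apply: disjJ; exists y.
Qed.

Theorem theorem5p3 (d : Order.disp_t) (B : ctbDistrLatticeType d)
    (C : B -> B -> Prop) :
  is_contact C ->
  contact_extensional C ->
  (contact_C4c C <-> (forall x : B, isolated C x)) /\
  ((forall x : B, isolated C x) <-> C = @overlap d B).
Proof.
move=> contactC extC; split; split.
- exact: contact_C4c_isolated.
(* Isolation lets [C] be replaced by overlap. *)
- by move=> /(isolated_contactE contactC) ->; apply: overlap_C4c.
- exact: isolated_contactE.
- by move=> -> x; apply: overlap_isolated.
Qed.
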